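(* Let $x=(x_1,x_2,\ldots,x_n)\in S_{\ell_1^n}$. Then $x$ is $\rho$-left symmetric if and only if at least one of the following holds: (i) $x\in Ext(B_{\ell_1^n})$; (ii) $|x_i|=|x_j|=\frac12$ for some $i,j\in\{1,2,\ldots,n\}$, and $x_k=0$ for all other indices $k$.
   Context: $\ell_1^n$ is $\mathbb{R}^n$ with the norm $\|x\|=\sum_{i=1}^n|x_i|$; $B_\mathbb{X}$ and $S_\mathbb{X}$ are the closed unit ball and unit sphere of a normed space $\mathbb{X}$, and $Ext(C)$ is the set of extreme points of a convex set $C$. Norm derivatives: $\rho'_{\pm}(x,y)=\|x\|\lim_{t\to 0^{\pm}}\frac{\|x+ty\|-\|x\|}{t}$ and $\rho'(x,y)=\frac12(\rho'_+(x,y)+\rho'_-(x,y))$. $\rho$-orthogonality: $x\perp_\rho y$ means $\rho'(x,y)=0$. An element $x\in\mathbb{X}$ is $\rho$-left symmetric if $x\perp_\rho y$ implies $y\perp_\rho x$ for all $y\in\mathbb{X}$. *)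

(* Defs.v *)
From HB Require Import structures.
From mathcomp Require Import all_boot all_order all_algebra.
From mathcomp Require Import boolp classical_sets reals topology normedtype.

Set Implicit Arguments.
Unset Strict Implicit.
Unset Printing Implicit Defensive.
Import Order.TTheory GRing.Theory Num.Theory.
Import numFieldNormedType.Exports.

Local Open Scope classical_set_scope.
Local Open Scope ring_scope.

Section NormedSpace.
Context {R : realType} {V : normedModType R}.

Definition unit_ball : set V := [set x | `|x| <= 1].

Definition unit_sphere : set V := [set x | `|x| = 1].

Definition Ext (C : set V) : set V :=
  [set x | C x /\
    forall (y z : V) (t : R), C y -> C z -> 0 < t < 1 ->
      x = t *: y + (1 - t) *: z -> y = x /\ z = x].

Definition rho_plus (x y : V) : R :=
  `|x| * lim ((`|x + t *: y| - `|x|) / t @[t --> (0 : R)^'+]).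

Definition rho_minus (x y : V) : R :=
  `|x| * lim ((`|x + t *: y| - `|x|) / t @[t --> (0 : R)^'-]).

Definition rho (x y : V) : R := 2^-1 * (rho_plus x y + rho_minus x y).

Definition rho_orthogonal (x y : V) : Prop := rho x y = 0.

Definition rho_left_symmetric (x : V) : Prop :=
  forall y : V, rho_orthogonal x y -> rho_orthogonal y x.

End NormedSpace.

Arguments unit_ball {R} V.
Arguments unit_sphere {R} V.

(* The library norms ['rV[R]_n] by the maximum of the entries.  The alias
   [ell1 R n] carries the same vector space structure, but the l1 norm. *)
Definition ell1 (R : realType) (n : nat) : Type := 'rV[R]_n.

Section Ell1.
Context (R : realType) (n : nat).

HB.instance Definition _ := GRing.Lmodule.copy (ell1 R n) 'rV[R]_n.

Definition entry (x : ell1 R n) (i : 'I_n) : R :=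
  fun_of_matrix (x : 'rV[R]_n) ord0 i.

Definition l1norm (x : ell1 R n) : R := \sum_(i < n) `|entry x i|.

Lemma entryD x y i : entry (x + y) i = entry x i + entry y i.
Proof. exact: mxE. Qed.

Lemma entryZ a x i : entry (a *: x) i = a * entry x i.
Proof. exact: mxE. Qed.

Lemma l1norm_triangle x y : l1norm (x + y) <= l1norm x + l1norm y.
Proof.
rewrite /l1norm -big_split; apply: ler_sum => i _ /=.
by rewrite entryD ler_normD.
Qed.

Lemma l1normZ a x : l1norm (a *: x) = `|a| * l1norm x.
Proof.
by rewrite /l1norm mulr_sumr; apply: eq_bigr => i _; rewrite entryZ normrM.
Qed.

Lemma l1norm_eq0 x : l1norm x = 0 -> x = 0.
Proof.
move=> /eqP; rewrite psumr_eq0 // => /allP x0; apply/rowP => i.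
have := x0 i (mem_index_enum i); rewrite normr_eq0 => /eqP xi0.
by rewrite mxE; exact: xi0.
Qed.

HB.instance Definition _ := @Lmodule_isNormed.Build R (ell1 R n)
  l1norm l1norm_triangle l1normZ l1norm_eq0.

Lemma ell1_normE (x : ell1 R n) : `|x| = \sum_(i < n) `|entry x i|.
Proof. by []. Qed.

End Ell1.

(* Main.v *)
Require Import Defs.
From mathcomp Require Import all_boot all_order all_algebra.
From mathcomp Require Import boolp classical_sets reals topology normedtype.
From mathcomp Require Import ring lra.
Import Order.TTheory GRing.Theory Num.Theory.
Import numFieldNormedType.Exports.
Local Open Scope classical_set_scope.
Local Open Scope ring_scope.

(* In [ell1], [rho x y = |x| * \sum_i sg x_i * y_i]: at the coordinates where
   [x] vanishes the two one-sided derivatives are opposite and cancel.  Hence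
   [x] is left symmetric iff [\sum_i sg x_i * y_i = 0] always forces
   [\sum_i sg y_i * x_i = 0].  Testing with [y = sg x_i e_i - sg x_j e_j] makes
   all nonzero [|x_i|] equal, and [y = 2 sg x_i e_i - sg x_j e_j - sg x_l e_l]
   excludes a support with three elements.  The extreme points of the unit ball
   are the unit vectors supported by a single coordinate. *)

(** * One-sided derivatives of the [ell1] norm *)

Section Rho.
Context {R : realType}.

(** For [a != 0] and small [t], [a + t * b] keeps the sign of [a], so the quotient is constant near
    0. [D] stands for one side of 0 and [e] for its sign, so both one-sided limits are covered at
    once. *)
Lemma norm_quotient_near (D : set R) (e a b : R) :
    (forall t, D t -> t != 0 /\ `|t| = e * t) ->
  \forall t \near within D (nbhs (0 : R)),
    (`|a + t * b| - `|a|) / t = Num.sg a * b + e * ((a == 0)%:R * `|b|).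
Proof.
move=> De; rewrite near_withinE.
have [->|a0] := eqVneq a 0.
  apply: nearW => t /De [t0 te].
  by rewrite sgr0 normr0 add0r subr0 normrM te mul1r; field.
(* Adding 1 keeps the radius [|a| / (|b| + 1)] meaningful when [b = 0]. *)
have b1_gt0 : 0 < `|b| + 1 by rewrite ltr_wpDl.
have d0 : 0 < `|a| / (`|b| + 1) by rewrite divr_gt0 ?normr_gt0.
apply: filterS (nbhs0_lt d0) => t; rewrite ltr_pdivlMr// => tb.
move=> /De [t0 _].
have {tb} : `|t * b| < `|a|.
  by rewrite normrM (le_lt_trans _ tb)// ler_wpM2l// lerDl ler01.
rewrite mul0r mulr0 addr0 ltr_norml.
have [a_lt0|a_gt0|/eqP] := ltgtP a 0; last by rewrite (negPf a0).
  rewrite (ltr0_norm a_lt0) ltr0_sg// => /andP[_ tb].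
  by rewrite ltr0_norm; [field|lra].
rewrite (gtr0_norm a_gt0) gtr0_sg// => /andP[tb _].
by rewrite gtr0_norm; [field|lra].
Qed.

Context {n : nat}.
Implicit Types x y : ell1 R n.

Lemma ell1_quotient_near (D : set R) (e : R) x y :
    (forall t, D t -> t != 0 /\ `|t| = e * t) ->
  \forall t \near within D (nbhs (0 : R)), (`|x + t *: y| - `|x|) / t =
  \sum_i (Num.sg (entry x i) * entry y i +
          e * ((entry x i == 0)%:R * `|entry y i|)).
Proof.
move=> De.
have /filter_forall : forall i : 'I_n,
    \forall t \near within D (nbhs (0 : R)),
    (`|entry x i + t * entry y i| - `|entry x i|) / t =
    Num.sg (entry x i) * entry y i + e * ((entry x i == 0)%:R * `|entry y i|).
  by move=> i; exact: norm_quotient_near.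
apply: filterS => t xy.
rewrite !ell1_normE -sumrB mulr_suml; apply: eq_bigr => i _.
by rewrite entryD entryZ xy.
Qed.

Lemma rho_ell1 x y : rho x y = `|x| * \sum_i Num.sg (entry x i) * entry y i.
Proof.
have right_norm (t : R) : 0 < t -> t != 0 /\ `|t| = 1 * t.
  by move=> t0; rewrite gt_eqF// gtr0_norm// mul1r.
have left_norm (t : R) : t < 0 -> t != 0 /\ `|t| = -1 * t.
  by move=> t0; rewrite lt_eqF// ltr0_norm// mulN1r.
have lim_right := lim_near_cst (@Rhausdorff R)
  (FF := at_right_proper_filter (0 : R))
  (ell1_quotient_near [set t | 0 < t] 1 x y right_norm).
have lim_left := lim_near_cst (@Rhausdorff R)
  (FF := at_left_proper_filter (0 : R))
  (ell1_quotient_near [set t | t < 0] (-1) x y left_norm).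
rewrite /rho /rho_plus /rho_minus lim_right lim_left.
by rewrite !big_split /= -!mulr_sumr; field.
Qed.

Lemma rho_orthogonal_ell1 x y :
  rho_orthogonal x y <-> \sum_i Num.sg (entry x i) * entry y i = 0.
Proof.
rewrite /rho_orthogonal rho_ell1; split=> [/eqP|->]; last exact: mulr0.
rewrite mulf_eq0 normr_eq0 => /orP[/eqP ->|/eqP //].
by rewrite big1// => i _; rewrite /entry mxE sgr0 mul0r.
Qed.

(** Testing with [y_k = sg x_k * c_k] removes the signs of [x] from both orthogonality relations. *)
Lemma rho_left_symmetric_weights x (c : 'I_n -> R) : rho_left_symmetric x ->
    \sum_k (entry x k != 0)%:R * c k = 0 ->
  \sum_k `|entry x k| * Num.sg (c k) = 0.
Proof.
move=> sym_x c0.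
pose y : ell1 R n := \row_k (Num.sg (entry x k) * c k).
have yE k : entry y k = Num.sg (entry x k) * c k by rewrite /entry mxE.
have /sym_x/rho_orthogonal_ell1 : rho_orthogonal x y.
  apply/rho_orthogonal_ell1; rewrite -[RHS]c0; apply: eq_bigr => k _.
  by rewrite yE mulrA -expr2 sqr_sg.
move=> yx; rewrite -[RHS]yx; apply: eq_bigr => k _.
by rewrite yE sgrM sgr_id mulrAC -normrEsg.
Qed.

End Rho.

(** * Supports and extreme points of the unit ball *)

Section Support.
Context {R : realType} {n : nat}.
Implicit Types x y : ell1 R n.

Lemma sum_mulr_delta (f : 'I_n -> R) i : \sum_k f k * (k == i)%:R = f i.
Proof.
rewrite (big_only1 i)// => [|k /negPf -> _]; last by rewrite mulr0.
by rewrite eqxx mulr1.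
Qed.

Lemma sum_two_support (f : 'I_n -> R) i j : i != j ->
  (forall k, k != i -> k != j -> f k = 0) -> \sum_k f k = f i + f j.
Proof.
move=> ij f0; rewrite (bigD1 i)//= (big_only1 j)//; first by rewrite eq_sym.
by move=> k kj ki; exact: f0.
Qed.

Lemma ell1P x y : (forall k, entry x k = entry y k) -> x = y.
Proof. by move=> xy; apply/rowP => k; exact: xy. Qed.

Lemma ell1_norm_single_support x i :
  (forall k, k != i -> entry x k = 0) -> `|x| = `|entry x i|.
Proof.
by move=> x0; rewrite ell1_normE (big_only1 i)// => k ki _; rewrite x0 ?normr0.
Qed.

Lemma ler_entry_ell1_norm x i k :
  k != i -> `|entry x i| + `|entry x k| <= `|x|.
Proof.
move=> ki; rewrite ell1_normE (bigD1 i)//= (bigD1 k)//= addrA lerDl.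
exact: sumr_ge0.
Qed.

Lemma unit_ball_single_support x i :
  `|x| <= 1 -> 1 <= `|entry x i| -> forall k, k != i -> entry x k = 0.
Proof.
move=> x1 xi k /(ler_entry_ell1_norm x) xik.
by apply/eqP; rewrite -normr_eq0 eq_le normr_ge0 andbT; lra.
Qed.

Lemma ext_ell1 x : `|x| = 1 ->
  Ext (unit_ball (ell1 R n)) x <-> exists i, forall k, k != i -> entry x k = 0.
Proof.
move=> x1; split=> [[_ ext_x]|[i x0]].
  have [i xi0] : exists i, entry x i != 0.
    apply/existsP; apply: contra_eqT x1; rewrite negb_exists => /forallP x0.
    rewrite ell1_normE big1 ?(eq_sym 0) ?oner_eq0// => i _.
    by have /negPn/eqP -> := x0 i; rewrite normr0.
  exists i; have [xi1|xi1] := leP 1 `|entry x i|.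
    by apply: unit_ball_single_support => //; rewrite x1.
  (* [x] lies on the segment from [sg x_i e_i] to the normalized remainder. *)
  pose y : ell1 R n := \row_k (Num.sg (entry x k) * (k == i)%:R).
  pose z : ell1 R n :=
    \row_k ((1 - `|entry x i|)^-1 * (entry x k * (k != i)%:R)).
  have yE k : entry y k = Num.sg (entry x k) * (k == i)%:R.
    by rewrite /entry mxE.
  have zE k : entry z k = (1 - `|entry x i|)^-1 * (entry x k * (k != i)%:R).
    by rewrite /entry mxE.
  have [yx _] : y = x /\ z = x.
    apply: (ext_x _ _ `|entry x i|).
    - rewrite /unit_ball /= (ell1_norm_single_support _ i) => [|k /negPf ki].
        by rewrite yE eqxx mulr1 normr_sg xi0.
      by rewrite yE ki mulr0.
    - rewrite /unit_ball /= ell1_normE.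
      under eq_bigr do rewrite zE normrM.
      rewrite -mulr_sumr gtr0_norm ?invr_gt0 ?subr_gt0//.
      (* With 1 written as [|x|], the normalizing factor is the norm of [x] without its entry
         [i]. *)
      rewrite ler_pdivrMl ?subr_gt0// mulr1 -[X in _ <= X - _]x1.
      rewrite ell1_normE [leRHS]addrC (bigD1 i)//= [in leRHS](bigD1 i)//=.
      rewrite eqxx mulr0 normr0 add0r addrA addNr add0r ler_sum// => k ki.
      by rewrite ki mulr1.
    - by rewrite normr_gt0 xi0.
    - apply: ell1P => k; rewrite entryD !entryZ yE zE.
      rewrite mulVKf ?subr_eq0 ?(gt_eqF xi1)//.
      have [->|_] := eqVneq k i; last by rewrite !mulr0 add0r mulr1.
      by rewrite mulr0 addr0 mulr1 mulrC -numEsg.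
  by move=> k /negPf ki; rewrite -yx yE ki mulr0.
have xi1 : `|entry x i| = 1 by rewrite -x1; exact/esym/ell1_norm_single_support.
split=> [|y z t y1 z1 /andP[t0 t1] xE]; first by rewrite /unit_ball /= x1.
(* The functional sending [w] to [s * entry w i] is at most 1 on the ball and takes the value 1 only
   at [x]. *)
set s := entry x i in xi1 *.
have ss : s * s = 1 by rewrite -expr2 -real_normK ?num_real// xi1 expr1n.
have entry_le1 (w : ell1 R n) : unit_ball (ell1 R n) w -> `|s * entry w i| <= 1.
  move=> w1; rewrite normrM xi1 mul1r; apply: le_trans w1.
  rewrite ell1_normE (bigD1 i)//= lerDl; exact: sumr_ge0.
have eq_x (w : ell1 R n) : unit_ball (ell1 R n) w -> s * entry w i = 1 -> w = x.
  move=> w1 swi.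
  have wi : entry w i = s by rewrite -[LHS]mul1r -ss -mulrA swi mulr1.
  have w0 := unit_ball_single_support w i w1.
  apply: ell1P => k.
  have [->//|ki] := eqVneq k i.
  by rewrite x0// w0// wi xi1.
have syz : t * (s * entry y i) + (1 - t) * (s * entry z i) = 1.
  have sE : s = t * entry y i + (1 - t) * entry z i.
    by rewrite -!entryZ -entryD -xE.
  by rewrite -[RHS]ss [X in _ = s * X]sE; ring.
have := entry_le1 _ y1; have := entry_le1 _ z1.
rewrite !ler_norml => /andP[_ sz] /andP[_ sy].
(* A proper convex combination of two numbers at most 1 equals 1 only if both do. *)
by split; apply: eq_x => //; nra.
Qed.

(** * Test vectors for left symmetry *)

Lemma rho_left_symmetric_norm_eq x i j : rho_left_symmetric x -> i != j ->
  entry x i != 0 -> entry x j != 0 -> `|entry x i| = `|entry x j|.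
Proof.
move=> sym_x /negPf ij xi xj.
pose c (k : 'I_n) : R := (k == i)%:R - (k == j)%:R.
have sgc k : Num.sg (c k) = c k.
  rewrite /c; have [->|_] := eqVneq k i; first by rewrite ij subr0 sgr1.
  by rewrite sub0r sgrN; case: eqP; rewrite ?sgr1 ?sgr0.
have sum_c (f : 'I_n -> R) : \sum_k f k * c k = f i - f j.
  by under eq_bigr do rewrite mulrBr; rewrite sumrB !sum_mulr_delta.
have : \sum_k `|entry x k| * Num.sg (c k) = 0.
  by apply: rho_left_symmetric_weights => //; rewrite sum_c xi xj subrr.
by under eq_bigr do rewrite sgc; rewrite sum_c => /eqP; rewrite subr_eq0 => /eqP.
Qed.

(** The weights 2, -1, -1 sum to 0, but passing to signs turns the 2 into 1, which leaves one
    absolute value balanced against two. *)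
Lemma rho_left_symmetric_norm_add x i j l : rho_left_symmetric x ->
    i != j -> i != l -> j != l ->
    entry x i != 0 -> entry x j != 0 -> entry x l != 0 ->
  `|entry x i| = `|entry x j| + `|entry x l|.
Proof.
move=> sym_x /negPf ij /negPf il /negPf jl xi xj xl.
pose c (k : 'I_n) : R := 2 * (k == i)%:R - (k == j)%:R - (k == l)%:R.
have sgc k : Num.sg (c k) = (k == i)%:R - (k == j)%:R - (k == l)%:R.
  rewrite /c; have [->|_] := eqVneq k i.
    by rewrite ij il !subr0 mulr1 gtr0_sg.
  have [->|_] := eqVneq k j; first by rewrite jl mulr0 !subr0 sub0r sgrN sgr1.
  by rewrite mulr0 !sub0r oppr0 sub0r sgrN; case: eqP; rewrite ?sgr1 ?sgr0.
have : \sum_k `|entry x k| * Num.sg (c k) = 0.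
  apply: rho_left_symmetric_weights => //.
  under eq_bigr do rewrite !mulrBr mulrCA.
  by rewrite !sumrB -mulr_sumr !sum_mulr_delta xi xj xl; ring.
under eq_bigr do rewrite sgc !mulrBr.
by rewrite !sumrB !sum_mulr_delta; lra.
Qed.

End Support.

Theorem theorem3p12 (R : realType) (n : nat) (x : ell1 R n)
    (hx : unit_sphere (ell1 R n) x) :
  rho_left_symmetric x <->
  (Ext (unit_ball (ell1 R n)) x \/
   exists i j : 'I_n,
     [/\ `|entry x i| = `|entry x j|, `|entry x j| = 2^-1 &
         forall k : 'I_n, k != i -> k != j -> entry x k = 0]).
Proof.
have x1 : `|x| = 1 := hx.
rewrite ext_ell1//; split=> [sym_x|].
  have [ext_x|not_ext] := pselect (exists i, forall k, k != i -> entry x k = 0).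
    by left.
  right.
  (* Used twice: from an arbitrary index it gives [i], and from [i] a second support index [j]. *)
  have another (l : 'I_n) : exists2 k, k != l & entry x k != 0.
    apply: contrapT => no_k; apply: not_ext; exists l => k kl.
    by apply/eqP/negPn/negP => xk; apply: no_k; exists k.
  have [l0] : exists l : 'I_n, True.
    apply: contrapT => no_l; move/eqP: x1.
    rewrite ell1_normE big1 ?(eq_sym 0) ?oner_eq0// => l _.
    by case: no_l; exists l.
  have [i _ xi] := another l0; have [j ji xj] := another i.
  have x0 k : k != i -> k != j -> entry x k = 0.
    move=> ki kj; apply/eqP/negPn/negP => xk.
    have ij : i != j by rewrite eq_sym.
    have ik : i != k by rewrite eq_sym.
    have jk : j != k by rewrite eq_sym.
    (* Together with [|x_i| = |x_j|], this forces the third entry to be 0. *)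
    have := rho_left_symmetric_norm_add x i j k sym_x ij ik jk xi xj xk.
    rewrite (rho_left_symmetric_norm_eq x i j)// => /eqP.
    by rewrite -subr_eq0 opprD addNKr oppr_eq0 normr_eq0 (negPf xk).
  have xij := rho_left_symmetric_norm_eq x j i sym_x ji xj xi.
  exists i, j; split=> //.
  move: x1; rewrite ell1_normE (sum_two_support _ i j) 1?eq_sym//; first by lra.
  by move=> k ki kj; rewrite x0// normr0.
move=> supp_x y /rho_orthogonal_ell1 xy; apply/rho_orthogonal_ell1.
(* With [p_k = sg x_k * y_k], it remains to deduce [\sum_k sg p_k * |x_k| = 0] from
   [\sum_k p_k = 0]. *)
have sg_swap k : Num.sg (entry y k) * entry x k =
    Num.sg (Num.sg (entry x k) * entry y k) * `|entry x k|.
  by rewrite sgrM sgr_id mulrAC -numEsg mulrC.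
under eq_bigr do rewrite sg_swap.
case: supp_x => [[i x0]|[i [j [xij xj x0]]]].
  rewrite (big_only1 i)// => [|k ki _]; last by rewrite x0// normr0 mulr0.
  move: xy; rewrite (big_only1 i)// => [->|k ki _]; first by rewrite sgr0 mul0r.
  by rewrite x0// sgr0 mul0r.
(* If [i = j], the norm of [x] would be 1/2. *)
have ij : i != j.
  apply/eqP => ij; move: x1; rewrite (ell1_norm_single_support x j).
    by rewrite xj; lra.
  by move=> k kj; rewrite x0// ij.
rewrite (sum_two_support _ i j)// => [|k ki kj]; last first.
  by rewrite x0// normr0 mulr0.
move: xy; rewrite (sum_two_support _ i j)// => [|k ki kj]; last first.
  by rewrite x0// sgr0 mul0r.
(* Now [p_i = - p_j], so the two signs are opposite and the equal weights cancel. *)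
move=> /eqP; rewrite addr_eq0 => /eqP ->.
by rewrite sgrN xij mulNr addNr.
Qed.
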